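(* Let $R_0 \in \mathcal P(\mathcal M_+(\mathbb T^d))$ be a probability distribution on $\mathcal M_+(\mathbb T^d)$. Then the functional $L^*_{R_0} : \mathcal M_+(\mathbb T^d) \to [0,+\infty]$, $$L_{R_0}^*(\rho) = \sup_{\sigma \in C(\mathbb T^d)} \Big\{ \langle \sigma, \rho \rangle - \log \mathbb E_{R_0}\big[ \exp(\langle \sigma, M\rangle)\big] \Big\},$$ is the lower semi-continuous envelope, for the topology of weak convergence of measures, of the functional $\mathrm{Init}_{R_0} : \mathcal M_+(\mathbb T^d) \to [0,+\infty]$, $$\mathrm{Init}_{R_0}(\rho) = \inf_{P_0} \Big\{ H(P_0|R_0) \ : \ P_0 \in \mathcal P(\mathcal M_+(\mathbb T^d)),\ \mathbb E_{P_0}[M] = \rho \Big\}.$$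
   Context: $\mathbb T^d$ is the $d$-dimensional flat torus. $\mathcal M_+(\mathbb T^d)$ is the set of finite nonnegative Borel measures on $\mathbb T^d$ with the topology of weak convergence (duality with $C(\mathbb T^d)$), and $\langle\sigma,\rho\rangle=\int\sigma\,d\rho$. $M$ denotes the identity map on $\mathcal M_+(\mathbb T^d)$, seen as a random measure. For $P_0\in\mathcal P(\mathcal M_+(\mathbb T^d))$, $\mathbb E_{P_0}[M]$ is the intensity measure $A \mapsto \mathbb E_{P_0}[M(A)]$. $H(P_0|R_0)=\mathbb E_{P_0}[\log \frac{dP_0}{dR_0}]$ if $P_0\ll R_0$ and $+\infty$ otherwise; $\inf\emptyset=+\infty$; $\log(+\infty)=+\infty$. The lower semi-continuous envelope of a functional $F$ is the largest lower semi-continuous functional that is $\leq F$ (the functionals may be extended by $+\infty$ to signed measures). *)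

(* Defs.v *)
From HB Require Import structures.
From mathcomp Require Import all_boot all_order all_algebra.
From mathcomp Require Import all_classical all_reals all_analysis.

Set Implicit Arguments.
Unset Strict Implicit.
Unset Printing Implicit Defensive.

Import Order.TTheory GRing.Theory Num.Theory.
Import numFieldNormedType.Exports.

Local Open Scope classical_set_scope.
Local Open Scope ring_scope.
Local Open Scope quotient_scope.

Section torus.
Context (R : realType) (d : nat).

Definition congr_Zd : rel 'rV[R]_d :=
  fun x y => [forall i, x ord0 i - y ord0 i \is a Num.int].

Lemma congr_Zd_refl : reflexive congr_Zd.
Proof. by move=> x; apply/forallP => i; rewrite subrr. Qed.

Lemma congr_Zd_sym : symmetric congr_Zd.
Proof.
by move=> x y; apply: eq_forallb => i; rewrite -opprB rpredN.
Qed.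

Lemma congr_Zd_trans : transitive congr_Zd.
Proof.
move=> y x z /forallP xy /forallP yz; apply/forallP => i.
by rewrite -(subrKA (y ord0 i)) rpredD.
Qed.

Definition congr_Zd_equiv :=
  EquivRel congr_Zd congr_Zd_refl congr_Zd_sym congr_Zd_trans.

(* The flat torus R^d / Z^d with its quotient topology and its Borel sets *)
Definition torus := {eq_quot congr_Zd_equiv}.

HB.instance Definition _ := Topological.copy torus (quotient_topology torus).
HB.instance Definition _ := Quotient.on torus.
HB.instance Definition _ := isPointed.Build torus (\pi_torus 0).
HB.instance Definition _ :=
  Measurable.copy torus (g_sigma_algebraType (@open torus)).

End torus.

Section finite_measures.
Context (R : realType) (d : nat).

(* A library measure is a function on all subsets of the torus, so an element
   of [fmeas] also carries irrelevant values on the non-Borel sets. Measures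
   that agree on the Borel sets are topologically indistinguishable below. *)
Definition fmeas := {finite_measure set (torus R d) -> \bar R}.

Definition pairing (sigma : torus R d -> R) (rho : fmeas) : R :=
  \int[rho]_x sigma x.

Definition pairing_map (rho : fmeas) :
    {ptws continuousType (torus R d) R -> R} :=
  fun sigma => pairing sigma rho.

HB.instance Definition _ := gen_eqMixin fmeas.
HB.instance Definition _ := gen_choiceMixin fmeas.
HB.instance Definition _ := isPointed.Build fmeas mzero.

(* Weak convergence: the coarsest topology that makes [pairing sigma]
   continuous for every continuous sigma *)
HB.instance Definition _ :=
  Topological.copy fmeas (initial_topology pairing_map).
HB.instance Definition _ :=
  Measurable.copy fmeas (g_sigma_algebraType (@open fmeas)).

End finite_measures.

Local Open Scope ereal_scope.
Local Open Scope charge_scope.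

Definition relative_entropy (disp : measure_display) (T : measurableType disp)
    (R : realType) (P Q : probability T R) : \bar R :=
  if `[< P `<< Q >] then
    \int[P]_x lne (('d (charge_of_finite_measure P) '/d Q) x)
  else +oo.

Definition intensity (R : realType) (d : nat)
    (P : probability (fmeas R d) R) (A : set (torus R d)) : \bar R :=
  \int[P]_m m A.

Definition has_intensity (R : realType) (d : nat)
    (P : probability (fmeas R d) R) (rho : fmeas R d) : Prop :=
  forall A : set (torus R d), measurable A -> intensity P A = rho A.

Definition Init (R : realType) (d : nat) (R0 : probability (fmeas R d) R)
    (rho : fmeas R d) : \bar R :=
  ereal_inf [set relative_entropy P0 R0 
                     | P0 in [set P | has_intensity P rho]].

Definition log_laplace (R : realType) (d : nat)
    (R0 : probability (fmeas R d) R) (sigma : torus R d -> R) : \bar R :=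
  lne (\int[R0]_m (expR (pairing sigma m))%:E).

Definition Lstar (R : realType) (d : nat) (R0 : probability (fmeas R d) R)
    (rho : fmeas R d) : \bar R :=
  ereal_sup [set (pairing sigma rho)%:E - log_laplace R0 sigma
            | sigma in [set: continuousType (torus R d) R]].

Definition is_lsc_envelope (R : realType) (X : topologicalType)
    (F G : X -> \bar R) : Prop :=
  [/\ lower_semicontinuous G,
      forall x, G x <= F x &
      forall K : X -> \bar R, lower_semicontinuous K ->
        (forall x, K x <= F x) -> forall x, K x <= G x].

(* Main.v *)
Require Import Defs.
From HB Require Import structures.
From mathcomp Require Import all_boot all_order all_algebra.
From mathcomp Require Import all_classical all_reals all_analysis.
From mathcomp Require Import measurable_realfun lra.

(** Why the theorem holds.

    As a supremum of functionals that are continuous or constantly infinite,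
    [Lstar] is lower semi-continuous. It lies below [Init] by the Gibbs
    inequality [donsker_varadhan], applied to the random variable
    <sigma, M>, whose mean under a law P with intensity rho is <sigma, rho>
    by Campbell's formula [campbell].

    For maximality, suppose that K is lower semi-continuous, K <= Init and
    a = Lstar rho < b < K rho. A weak neighborhood of rho on which K > b
    constrains only finitely many pairings <s_i, .>, up to some e > 0
    ([nbhs_fmeasP]). A law P with H(P|R0) <= b whose intensity lies in that
    neighborhood contradicts K <= Init, and [exists_nearby_intensity] provides
    one. Only the random vector
    X_i = <s_i, M> - <s_i, rho> matters, and Lstar rho <= a says that
    E exp(l.X) >= exp(-a) for every vector l.

    The law P is an exponential tilt of R0, which replaces a separation
    argument in the space of measures. Let B_k be the event that M has mass
    at most k and Z_k(l) = E[exp(l.X); B_k]. These functions are finite and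
    increase to E exp(l.X), so that by compactness of the box |l_i| <= r some
    k satisfies Z_k > exp(-b) on the whole box ([exists_truncation]). Let l
    minimize Z_k over the box and let P have density exp(l.X) 1_(B_k) / Z_k(l).
    The first-order condition at l, tested against a suitable point of the box,
    gives l.E_P X <= - r sum_i |E_P X_i| ([exists_box_critical_point]). Hence
        0 <= H(P|R0) = l.E_P X - log Z_k(l) <= b - r sum_i |E_P X_i|,
    which bounds the entropy by b and every |E_P X_i| by b / r, smaller than e
    once r is large. Since the neighborhood is open, the moments need only be
    matched approximately, and the constraint to the box makes the existence of
    a minimizer automatic. The truncation makes the intensity of P finite.

    The intensity makes sense because m |-> m A is Borel for the weak topology
    ([measurable_eval]): the indicator of an open set is an increasing limit of
    continuous functions, built from the distance in R^d. *)

Set Implicit Arguments.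
Unset Strict Implicit.
Unset Printing Implicit Defensive.

Import Order.TTheory GRing.Theory Num.Theory.
Import numFieldNormedType.Exports.

Local Open Scope classical_set_scope.
Local Open Scope ring_scope.
Local Open Scope quotient_scope.

(** * Densities and the entropy inequality *)

Section density_existence.
Local Open Scope ereal_scope.
Context d (T : measurableType d) (R : realType) (Q : probability T R).
Variable g : T -> R.
Hypothesis mg : measurable_fun [set: T] g.
Hypothesis g0 : forall x, (0 <= g x)%R.
Hypothesis g1 : \int[Q]_x (g x)%:E = 1.

Let P A := \int[Q]_(x in A) (g x)%:E.

Let P0 : P set0 = 0. Proof. exact: integral_set0. Qed.

Let P_ge0 A : 0 <= P A.
Proof. by apply: integral_ge0 => x _; rewrite lee_fin. Qed.

Let P_sigma_additive : semi_sigma_additive P.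
Proof.
move=> F mF tF mUF; rewrite /P ge0_integral_bigcup//.
- apply: is_cvg_ereal_nneg_natsum_cond => k _ _; exact: P_ge0.
- exact/measurable_funTS/measurable_EFinP.
- by move=> x _; rewrite lee_fin.
Qed.

HB.instance Definition _ := isMeasure.Build _ _ _ P P0 P_ge0 P_sigma_additive.
HB.instance Definition _ := @Measure_isProbability.Build _ _ R P g1.

Lemma exists_probability_density : exists P : probability T R,
  forall A, measurable A -> P A = \int[Q]_(x in A) (g x)%:E.
Proof. by exists P. Qed.

End density_existence.

Section density.
Local Open Scope ereal_scope.
Local Open Scope charge_scope.
Context d (T : measurableType d) (R : realType) (P Q : probability T R).
Variable g : T -> R.
Hypothesis mg : measurable_fun [set: T] g.
Hypothesis g0 : forall x, (0 <= g x)%R.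
Hypothesis Pg : forall A, measurable A -> P A = \int[Q]_(x in A) (g x)%:E.

Lemma density_dominates : P `<< Q.
Proof.
apply/null_content_dominatesP => A mA QA0; rewrite Pg//.
by apply: null_set_integral => //; exact/measurable_funTS/measurable_EFinP.
Qed.

Let numu : charge_of_finite_measure P `<< Q := density_dominates.

Let mRN : measurable_fun [set: T] ('d (charge_of_finite_measure P) '/d Q).
Proof. exact: measurable_int (Radon_Nikodym_integrable numu). Qed.

Lemma ae_eq_density :
  ae_eq Q setT ('d (charge_of_finite_measure P) '/d Q) (EFin \o g).
Proof.
apply: integral_ae_eq => //.
- exact: Radon_Nikodym_integrable numu.
- exact/measurable_EFinP.
- move=> E _ mE; rewrite -Radon_Nikodym_integral//.
  exact: Pg.
Qed.

Lemma integral_density E (f : T -> \bar R) : measurable E -> P.-integrable E f ->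
  \int[P]_(x in E) f x = \int[Q]_(x in E) (f x * (g x)%:E).
Proof.
move=> mE fi; rewrite -(Radon_Nikodym_change_of_variables density_dominates)//.
have mf := measurable_int _ fi.
apply: ae_eq_integral => //.
- apply: emeasurable_funM => //; exact: measurable_funTS.
- by apply: emeasurable_funM => //; exact/measurable_EFinP/measurable_funTS.
- exact/ae_eqe_mul2l/(ae_eq_subset _ ae_eq_density).
Qed.

Lemma ge0_integral_density (f : T -> \bar R) :
  measurable_fun [set: T] f -> (forall x, 0 <= f x) ->
  \int[P]_x f x = \int[Q]_x (f x * (g x)%:E).
Proof.
move=> mf f0.
rewrite -(Radon_Nikodym_SigmaFinite.change_of_variables density_dominates)//.
apply: ae_eq_integral => //.
- apply: emeasurable_funM => //.
  exact: measurable_int (Radon_Nikodym_SigmaFinite.f_integrable density_dominates).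
- by apply: emeasurable_funM => //; exact/measurable_EFinP.
apply: ae_eqe_mul2l; apply: ae_eq_trans ae_eq_density.
by apply: ae_eq_Radon_Nikodym_SigmaFinite => //; exact: density_dominates.
Qed.

Lemma density_gt0_ae : {ae P, forall x, (0 < g x)%R}.
Proof.
exists (g @^-1` [set 0%R]); split.
- by rewrite -[X in measurable X]setTI; exact: mg.
- rewrite Pg; last by rewrite -[X in measurable X]setTI; exact: mg.
  by apply: integral0_eq => x /= ->.
- move=> x /= /negP; rewrite -leNgt => gx.
  by apply/eqP; rewrite eq_le gx g0.
Qed.

(** Where g vanishes, lne is -oo whereas ln is 0, but this happens only on a
    P-null set. *)
Lemma relative_entropy_density : relative_entropy P Q = \int[P]_x (ln (g x))%:E.
Proof.
rewrite /relative_entropy asboolT; last exact: density_dominates.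
have Rfin x := Radon_Nikodym_fin_num x numu.
apply: ae_eq_integral => //.
- rewrite [X in measurable_fun _ X](_ : _ = (fun x =>
      if (fine (('d (charge_of_finite_measure P) '/d Q) x) <= 0)%R then -oo
      else (ln (fine (('d (charge_of_finite_measure P) '/d Q) x)))%:E)); last first.
    by apply/funext => x; rewrite -{1}(fineK (Rfin x)).
  apply: measurable_fun_ifT => //.
  + by apply: measurable_fun_ler => //; apply: measurableT_comp.
  + apply/measurable_EFinP/measurableT_comp => //; exact: measurableT_comp.
- by apply/measurable_EFinP; exact: measurableT_comp.
have := null_dominates_ae_eq measurableT density_dominates ae_eq_density.
move=> aePg; apply: filterS2 aePg density_gt0_ae => x /= + gx _.
by move=> -> //=; rewrite leNgt gx.
Qed.

End density.

Lemma probability_integral_cst d (T : measurableType d) (R : realType)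
  (P : probability T R) (r : R) : (\int[P]_x r%:E = r%:E)%E.
Proof.
rewrite integral_cst// -[RHS]mule1; congr (_ * _)%E; exact: probability_setT.
Qed.

Section donsker_varadhan.
Local Open Scope ereal_scope.
Context d (T : measurableType d) (R : realType).

(** Comparing positive and negative parts separately covers a g of infinite
    integral, such as a log-density when the relative entropy is +oo. *)
Lemma le_integral_measurable (mu : {measure set T -> \bar R}) (f g : T -> \bar R) :
  measurable_fun [set: T] f -> measurable_fun [set: T] g ->
  (forall x, f x <= g x) -> \int[mu]_x f x <= \int[mu]_x g x.
Proof.
move=> mf mg fg; rewrite integralE [leRHS]integralE leeB//.
- apply: ge0_le_integral => //; [exact: measurable_funepos..|].
  by move=> x _; apply: (@funepos_le _ _ setT) => [y _|]; [exact: fg|rewrite inE].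
- apply: ge0_le_integral => //; [exact: measurable_funeneg..|].
  by move=> x _; apply: (@funeneg_le _ _ setT) => [y _|]; [exact: fg|rewrite inE].
Qed.

Context (P Q : probability T R).

(** With c the logarithm of the Q-integral of expR phi and g the density of P,
    the inequality 1 + y <= expR y at y = phi - c - ln g reads
    phi - c + 1 - u <= ln g, where u = expR y. It remains to integrate against P:
    since u g <= expR (phi - c), the P-integral of u is at most 1. *)
Lemma donsker_varadhan (phi : T -> R) : measurable_fun [set: T] phi ->
  P.-integrable [set: T] (EFin \o phi) ->
  \int[P]_x (phi x)%:E - lne (\int[Q]_x (expR (phi x))%:E) <= relative_entropy P Q.
Proof.
move=> mphi iphi.
have iphi_fin := integrable_fin_num measurableT iphi.
have [PQ|PQ] := pselect (P `<< Q); last first.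
  by rewrite /relative_entropy asboolF// leey.
have Z_gt0 : 0 < \int[Q]_x (expR (phi x))%:E.
  rewrite lt0e integral_ge0 ?andbT; last by move=> x _; rewrite lee_fin expR_ge0.
  apply/eqP => Z0.
  have mE : measurable_fun [set: T] (fun x => (expR (phi x))%:E).
    by apply/measurable_EFinP; exact: measurableT_comp.
  have [|N [mN QN0 N_sub]] := (ae_eq_integral_abs Q measurableT mE).1.
    rewrite -[RHS]Z0; apply: eq_integral => x _.
    by rewrite gee0_abs// lee_fin expR_ge0.
  have NT : N = setT.
    apply/seteqP; split => // x _; apply: N_sub => /= /(_ I)/eqP.
    by rewrite eqe gt_eqF// expR_gt0.
  have := probability_setT Q; rewrite -NT [LHS]QN0 => /eqP.
  by rewrite eq_sym onee_eq0.
case: (ltP (\int[Q]_x (expR (phi x))%:E) +oo) => [Zoo|]; last first.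
  by rewrite leye_eq => /eqP -> /=; rewrite addeNy leNye.
have /fineK Zfin : \int[Q]_x (expR (phi x))%:E \is a fin_num.
  by rewrite gt0_fin_numE.
set Z := fine _ in Zfin; rewrite -Zfin in Z_gt0 *; rewrite lte_fin in Z_gt0.
rewrite lne_EFin//; set c := ln Z.
pose f := Radon_Nikodym_SigmaFinite.f P Q; pose g := fine \o f.
have mf := measurable_int _ (Radon_Nikodym_SigmaFinite.f_integrable PQ).
have mg : measurable_fun [set: T] g by exact: measurableT_comp.
have fg x : (g x)%:E = f x by rewrite fineK// Radon_Nikodym_SigmaFinite.f_fin_num.
have g0 x : (0 <= g x)%R by rewrite -lee_fin fg Radon_Nikodym_SigmaFinite.f_ge0.
have Pg A : measurable A -> P A = \int[Q]_(x in A) (g x)%:E.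
  move=> mA; rewrite (Radon_Nikodym_SigmaFinite.f_integral PQ)//.
  by apply: eq_integral => x _; rewrite fg.
rewrite (relative_entropy_density mg g0 Pg).
have mlng : measurable_fun [set: T] (fun x => ln (g x)) by exact: measurableT_comp.
pose u x := expR (phi x - c - ln (g x)).
have mu : measurable_fun [set: T] u.
  by apply: measurableT_comp => //; do 2 apply: measurable_funB => //.
have iu : \int[P]_x (u x)%:E <= 1.
  rewrite (ge0_integral_density mg Pg);
    [|exact/measurable_EFinP|by move=> x; rewrite lee_fin expR_ge0].
  apply: (@le_trans _ _ (\int[Q]_x ((Z^-1)%:E * (expR (phi x))%:E))).
    apply: ge0_le_integral => //.
    - by move=> x _; rewrite -EFinM lee_fin mulr_ge0// expR_ge0.
    - by apply/measurable_EFinP/measurable_funM.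
    - by apply/measurable_EFinP/measurable_funM => //; exact: measurableT_comp.
    move=> x _; rewrite -!EFinM lee_fin.
    have := g0 x; rewrite le_eqVlt => /predU1P[<-|gx].
      by rewrite mulr0 mulr_ge0 ?expR_ge0// invr_ge0 ltW.
    by rewrite /u 2!expRB !lnK ?posrE// divfK ?gt_eqF// mulrC.
  rewrite ge0_integralZl//.
  - by rewrite -Zfin -EFinM mulVf ?gt_eqF.
  - by apply/measurable_EFinP; exact: measurableT_comp.
  - by rewrite lee_fin invr_ge0 ltW.
have iuP : P.-integrable [set: T] (EFin \o u).
  apply/integrableP; split; first exact/measurable_EFinP.
  under eq_integral do rewrite /= ger0_norm ?expR_ge0//.
  by rewrite (le_lt_trans iu)// ltry.
have i1 : P.-integrable [set: T] (EFin \o (fun x => phi x - u x)%R).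
  by apply: (eq_integrable measurableT) (integrableB measurableT iphi iuP).
have ic : P.-integrable [set: T] (EFin \o (fun=> 1 - c)%R).
  exact: finite_measure_integrable_cst.
apply: (@le_trans _ _ (\int[P]_x ((phi x - u x)%:E + (1 - c)%:E))); last first.
  apply: le_integral_measurable.
  - by apply: emeasurable_funD => //; apply/measurable_EFinP/measurable_funB.
  - exact/measurable_EFinP.
  move=> x; rewrite -EFinD lee_fin.
  have := expR_ge1Dx (phi x - c - ln (g x)); rewrite -/(u x); lra.
rewrite integralD//= probability_integral_cst.
rewrite integralB_EFin//.
move: iu; rewrite -(fineK (integrable_fin_num measurableT iuP)) -(fineK iphi_fin).
rewrite !lee_fin => iu; lra.
Qed.

Lemma relative_entropy_ge0 : 0 <= relative_entropy P Q.
Proof.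
have := @donsker_varadhan (fun=> 0%R) (measurable_cst _)
  (finite_measure_integrable_cst _ _ measurableT).
by rewrite /= expR0 !probability_integral_cst lne1 oppe0 adde0.
Qed.

End donsker_varadhan.

(** * Bounded integrands and bounds on the exponential *)

Section exp_bounds.
Context {R : realType}.
Implicit Types u v c : R.

Lemma expR_lipschitz u v c : u <= c -> v <= c ->
  `|expR v - expR u| <= expR c * `|v - u|.
Proof.
wlog uv : u v / u <= v => [wl uc vc|uc vc].
  by have [/wl|/ltW/wl] := leP u v; [exact|rewrite distrC (distrC v); exact].
rewrite !ger0_norm ?subr_ge0 ?ler_expR//.
have h1 : expR v * (1 + (u - v)) <= expR u.
  have -> : expR u = expR v * expR (u - v) by rewrite -expRD subrKC.
  by rewrite ler_pM2l ?expR_gt0// expR_ge1Dx.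
have h2 : expR v * (v - u) <= expR c * (v - u).
  by rewrite ler_wpM2r ?subr_ge0// ler_expR.
lra.
Qed.

(** From expR u <= 1 / (1 - u), a form of 1 - u <= expR (- u). *)
Lemma expR_le_quadratic u : u <= 2^-1 -> expR u <= 1 + u + 2 * u ^+ 2.
Proof.
move=> u2; have h := expR_ge1Dx (- u); have e0 := expR_gt0 u.
have h1 : expR u * (1 - u) <= 1.
  rewrite (le_trans (ler_wpM2l (ltW e0) h))//.
  by rewrite -expRD subrr expR0.
have u0 : 0 < 1 - u by lra.
rewrite -(ler_pM2r u0) (le_trans h1)//.
nra.
Qed.

End exp_bounds.

Section bounded_measurable_functions.
Context d (T : measurableType d) (R : realType).
Context (mu : {finite_measure set T -> \bar R}).
Variables (B : set T) (mB : measurable B).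
Implicit Types f g : T -> R.

(** A class that contains everything built from bounded X_i by sums, products
    and expR, so that all integrals over a truncation event are finite. *)
Definition bounded_measurable f :=
  measurable_fun B f /\ exists M, forall x, B x -> `|f x| <= M.

Lemma bounded_measurable_cst c : bounded_measurable (fun=> c).
Proof. by split; [exact: measurable_cst|exists `|c|]. Qed.

Lemma bounded_measurableD f g :
  bounded_measurable f -> bounded_measurable g ->
  bounded_measurable (fun x => f x + g x).
Proof.
move=> [mf [M fM]] [mg [N gN]]; split; first exact: measurable_funD.
by exists (M + N) => x Bx; rewrite (le_trans (ler_normD _ _))// lerD ?fM ?gN.
Qed.

Lemma bounded_measurableM f g :
  bounded_measurable f -> bounded_measurable g ->
  bounded_measurable (fun x => f x * g x).
Proof.
move=> [mf [M fM]] [mg [N gN]]; split; first exact: measurable_funM.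
by exists (M * N) => x Bx; rewrite normrM ler_pM ?fM ?gN.
Qed.

Lemma bounded_measurable_sum I (s : seq I) (f : I -> T -> R) :
  (forall i, bounded_measurable (f i)) ->
  bounded_measurable (fun x => \sum_(i <- s) f i x).
Proof.
move=> bf; elim: s => [|a s IH].
  by under eq_fun do rewrite big_nil; exact: bounded_measurable_cst.
by under eq_fun do rewrite big_cons; exact: bounded_measurableD.
Qed.

Lemma bounded_measurable_expR f :
  bounded_measurable f -> bounded_measurable (fun x => expR (f x)).
Proof.
move=> [mf [M fM]]; split; first exact: measurableT_comp.
exists (expR M) => x Bx; rewrite ger0_norm ?expR_ge0// ler_expR.
by rewrite (le_trans (ler_norm _))// fM.
Qed.

Lemma bounded_measurable_integrable f :
  bounded_measurable f -> mu.-integrable B (EFin \o f).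
Proof.
move=> [mf [M fM]]; apply: measurable_bounded_integrable => //.
  by rewrite -ge0_fin_numE// fin_num_measure.
exists M; split; first exact: num_real.
by move=> N MN x Bx /=; rewrite (le_trans (fM _ Bx))// ltW.
Qed.

Lemma Rintegral_sum (I : Type) (s : seq I) (f : I -> T -> R) :
  (forall i, bounded_measurable (f i)) ->
  \int[mu]_(x in B) (\sum_(i <- s) f i x) = \sum_(i <- s) \int[mu]_(x in B) f i x.
Proof.
move=> bf; elim: s => [|i s IH].
  under eq_Rintegral do rewrite big_nil.
  by rewrite Rintegral_cst// mul0r big_nil.
under eq_Rintegral do rewrite big_cons.
rewrite RintegralD// ?IH ?big_cons//; apply: bounded_measurable_integrable => //.
exact: bounded_measurable_sum.
Qed.

End bounded_measurable_functions.

(** * Partition functions and their constrained minimizers *)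

Section partition_function.
Context d (T : measurableType d) (R : realType) (Q : probability T R).
Context (n : nat) (X : 'I_n -> T -> R).
Implicit Types (l m : 'rV[R]_n) (x : T) (B : set T).

Lemma rV_entry_le_norm l i : `|l ord0 i| <= `|l|.
Proof.
rewrite [leRHS]mx_normrE.
exact: (le_bigmax _ (fun ij => `|l ij.1 ij.2|) (ord0, i)).
Qed.

Definition lin_form l x := \sum_(i < n) l ord0 i * X i x.

(** The Laplace transform of the law of X, restricted to the event B. *)
Definition partition_fun B l := \int[Q]_(x in B) expR (lin_form l x).

Lemma lin_formD l m x : lin_form (l + m) x = lin_form l x + lin_form m x.
Proof.
by rewrite /lin_form -big_split/=; apply: eq_bigr => i _; rewrite mxE mulrDl.
Qed.

Lemma lin_formZ c l x : lin_form (c *: l) x = c * lin_form l x.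
Proof. by rewrite /lin_form mulr_sumr; apply: eq_bigr => i _; rewrite mxE mulrA. Qed.

Section bounded_on_B.
Variable (B : set T).
Hypothesis mB : measurable B.
Hypothesis bX : forall i, bounded_measurable B (X i).

Lemma bounded_measurable_lin_form l : bounded_measurable B (lin_form l).
Proof.
apply: bounded_measurable_sum => i; apply: bounded_measurableM => //.
exact: bounded_measurable_cst.
Qed.

Lemma lin_form_bound : exists2 C : R, 0 <= C &
  forall l x, B x -> `|lin_form l x| <= C * `|l|.
Proof.
have /choice[M XM] : forall i, exists M, forall x, B x -> `|X i x| <= M.
  by move=> i; have [] := bX i.
exists (\sum_i `|M i|); first exact: sumr_ge0.
move=> l x Bx; rewrite (le_trans (ler_norm_sum _ _ _))// mulr_suml ler_sum//.
move=> i _; rewrite normrM mulrC ler_pM//.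
  by rewrite (le_trans (XM _ _ Bx))// ler_norm.
exact: rV_entry_le_norm.
Qed.

Lemma bounded_measurable_expR_lin_form l :
  bounded_measurable B (fun x => expR (lin_form l x)).
Proof. exact/bounded_measurable_expR/bounded_measurable_lin_form. Qed.

Let ibl l : Q.-integrable B (EFin \o (fun x => expR (lin_form l x))).
Proof. exact/bounded_measurable_integrable/bounded_measurable_expR_lin_form. Qed.

(** On B the linear forms with parameter in the unit ball around l are uniformly
    bounded, and expR is Lipschitz on bounded sets. *)
Lemma continuous_partition_fun : continuous (partition_fun B).
Proof.
have [C C0 dC] := lin_form_bound.
move=> l.
apply/(pseudometric_normed_Zmodule.cvgrPdist_le (FF := nbhs_filter l)) => e e0.
set K := expR (C * (`|l| + 1)) * C.
have K0 : 0 <= K by rewrite mulr_ge0// expR_ge0.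
have near_le (e' : R) : 0 < e' -> \forall m \near l, `|l - m| <= e'.
  by move=> e'0; apply/nbhs_ballP; exists e' => //= y; rewrite -ball_normE => /ltW.
near=> m.
have ml1 : `|l - m| <= 1 by near: m; exact: near_le.
have mle : `|l - m| <= e / (K + 1).
  by near: m; apply: near_le; rewrite divr_gt0// ltr_wpDl.
have lm : `|m| <= `|l| + 1.
  by rewrite -lerBlDl (le_trans _ ml1)// distrC (le_trans _ (lerB_dist _ _)).
have le_bound p : `|p| <= `|l| + 1 ->
    forall x, B x -> lin_form p x <= C * (`|l| + 1).
  move=> pl x Bx; rewrite (le_trans (ler_norm _))// (le_trans (dC _ _ Bx))//.
  by rewrite ler_wpM2l.
rewrite /partition_fun -RintegralB//.
have bdiff :
    bounded_measurable B (fun x => expR (lin_form l x) - expR (lin_form m x)).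
  under eq_fun do rewrite -mulN1r.
  apply: bounded_measurableD; first exact: bounded_measurable_expR_lin_form.
  apply: bounded_measurableM; first exact: bounded_measurable_cst.
  exact: bounded_measurable_expR_lin_form.
rewrite (le_trans (le_normr_Rintegral _ _))//.
  exact: bounded_measurable_integrable.
apply: (@le_trans _ _ (\int[Q]_(x in B) (K * `|l - m|))).
  apply: le_Rintegral => //.
  - exact/integrable_norm/bounded_measurable_integrable.
  - exact/bounded_measurable_integrable/bounded_measurable_cst.
  move=> x Bx.
  apply: (@le_trans _ _ (expR (C * (`|l| + 1)) * `|lin_form l x - lin_form m x|)).
    by rewrite expR_lipschitz// le_bound// lerDl.
  rewrite /K -mulrA ler_wpM2l ?expR_ge0//.
  have -> : lin_form l x - lin_form m x = lin_form (l - m) x.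
    by rewrite lin_formD -[- m]scaleN1r lin_formZ mulN1r.
  exact: dC.
rewrite Rintegral_cst//.
have QB : 0 <= fine (Q B) <= 1.
  rewrite fine_ge0//= -lee_fin fineK ?fin_num_measure//; exact: probability_le1.
rewrite (@le_trans _ _ (K * `|l - m|))//.
  by case/andP: QB => ? ?; rewrite ler_piMr// mulr_ge0.
rewrite (le_trans (ler_wpM2l K0 mle))// mulrA ler_pdivrMr ?ltr_wpDl//.
by rewrite mulrC ler_wpM2l// ?(ltW e0)// lerDl.
Unshelve. all: by end_near. Qed.

End bounded_on_B.
End partition_function.

Section gibbs.
Context d (T : measurableType d) (R : realType) (Q : probability T R).
Context (n : nat) (X : 'I_n -> T -> R).
Implicit Types (l m : 'rV[R]_n) (x : T) (B : set T).
Local Notation dot := (lin_form X).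
Local Notation Z := (partition_fun Q X).

Definition box r : set 'rV[R]_n := [set l | forall i, - r <= l ord0 i <= r].

Lemma box_compact r : compact (box r).
Proof.
exact: (@rV_compact R n (fun=> `[- r, r]%classic) (fun=> @segment_compact _ _ _)).
Qed.

Lemma box_convex r l m (t : R) : 0 <= t <= 1 -> box r l -> box r m ->
  box r (l + t *: (m - l)).
Proof.
move=> /andP[t0 t1] bl bm i; move: (bl i) (bm i) => /=; rewrite !mxE.
set a := l ord0 i; set b := m ord0 i => la lb; nra.
Qed.

(** The mean of X_i under the tilted law, up to the factor 1 / Z; it is also the
    i-th partial derivative of Z. *)
Definition moment B l i := \int[Q]_(x in B) (X i x * expR (dot l x)).

Section bounded_on_B.
Variable (B : set T).
Hypothesis mB : measurable B.
Hypothesis bX : forall i, bounded_measurable B (X i).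

Let bE l : bounded_measurable B (fun x => expR (dot l x)).
Proof. exact: bounded_measurable_expR_lin_form. Qed.

Let bXE (f : T -> R) l : bounded_measurable B f ->
  bounded_measurable B (fun x => f x * expR (dot l x)).
Proof. by move=> bf; exact: bounded_measurableM. Qed.

Let bZ (c : R) (f : T -> R) :
  bounded_measurable B f -> bounded_measurable B (fun x => c * f x).
Proof. by apply: bounded_measurableM; exact: bounded_measurable_cst. Qed.

Let int f : bounded_measurable B f -> Q.-integrable B (EFin \o f).
Proof. exact: bounded_measurable_integrable. Qed.

Lemma Rintegral_lin_form_expR m l :
  \int[Q]_(x in B) (dot m x * expR (dot l x)) = \sum_i m ord0 i * moment B l i.
Proof.
under eq_Rintegral do rewrite /lin_form mulr_suml.
rewrite Rintegral_sum// => [|i]; last first.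
  by apply: bXE; apply: bZ; exact: bX.
apply: eq_bigr => i _; under eq_Rintegral do rewrite -mulrA.
by rewrite RintegralZl//; apply: int; apply: bXE; exact: bX.
Qed.

(** The segment from l to m stays in the box, so Z at l + t (m - l) is at least
    Z at l; by the quadratic bound on expR the difference is at most
    t D + t^2 K, where D is the integral in the conclusion. For small t this
    forces D >= 0. *)
Lemma box_minimizer_first_order r l m : box r l -> box r m ->
  (forall p, box r p -> Z B l <= Z B p) ->
  0 <= \int[Q]_(x in B) (dot (m - l) x * expR (dot l x)).
Proof.
move=> bl bm min_l; set D := (X in 0 <= X).
have [C C0 dC] := lin_form_bound bX.
set c := C * `|m - l|.
have c0 : 0 <= c by rewrite mulr_ge0.
have Z0 : 0 <= Z B l by rewrite Rintegral_ge0// => x _; exact: expR_ge0.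
have bU : bounded_measurable B (dot (m - l)) by exact: bounded_measurable_lin_form.
set K := 2 * c ^+ 2 * Z B l.
have K0 : 0 <= K by rewrite !mulr_ge0.
have key t : 0 <= t <= 1 -> t * c <= 2^-1 -> 0 <= t * D + t ^+ 2 * K.
  move=> /andP[t0 t1] tc.
  have /min_l : box r (l + t *: (m - l)) by apply: box_convex => //; rewrite t0 t1.
  suff : Z B (l + t *: (m - l)) <= Z B l + (t * D + t ^+ 2 * K) by lra.
  have b1 : bounded_measurable B (fun x => t * (dot (m - l) x * expR (dot l x))).
    by apply: bZ; exact: bXE.
  have b2 : bounded_measurable B (fun x => (t ^+ 2 * (2 * c ^+ 2)) * expR (dot l x)).
    exact: bZ.
  have -> : Z B l + (t * D + t ^+ 2 * K) = \int[Q]_(x in B) (expR (dot l x) +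
      (t * (dot (m - l) x * expR (dot l x)) + (t ^+ 2 * (2 * c ^+ 2)) * expR (dot l x))).
    rewrite RintegralD//; [|exact: int|by apply: int; exact: bounded_measurableD].
    rewrite RintegralD//; [|exact: int|exact: int].
    rewrite RintegralZl//; last by apply: int; exact: bXE.
    rewrite RintegralZl//; last exact: int.
    by rewrite /K /partition_fun mulrA.
  apply: le_Rintegral => //.
  - exact: int.
  - by apply: int; do 2 apply: bounded_measurableD => //.
  move=> x Bx; rewrite lin_formD lin_formZ expRD.
  set e := expR (dot l x); set u := dot (m - l) x.
  have e0 : 0 <= e by exact: expR_ge0.
  have uc : `|u| <= c by exact: dC.
  have u2 : u ^+ 2 <= c ^+ 2 by rewrite -real_normK ?num_real// lerXn2r ?nnegrE.
  have tu : t * u <= 2^-1.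
    by rewrite (le_trans _ tc)// ler_wpM2l// (le_trans (ler_norm _)).
  have := ler_wpM2l e0 (expR_le_quadratic tu).
  have : e * (2 * (t ^+ 2 * u ^+ 2)) <= e * (2 * (t ^+ 2 * c ^+ 2)).
    by rewrite !ler_wpM2l// exprn_ge0.
  rewrite exprMn; lra.
rewrite leNgt; apply/negP => D0.
(* If D < 0, then t = 1 / S satisfies t <= 1, t c <= 1 / 2 and t K < - D. *)
set S := 1 + 2 * c + 2 * K / - D.
have KD0 : 0 <= 2 * K / - D by rewrite divr_ge0 ?mulr_ge0// oppr_ge0 ltW.
have S1 : 1 <= S by rewrite /S; lra.
have S0 : 0 < S by lra.
have := key S^-1; rewrite invr_ge0 (ltW S0)/= invf_le1// S1 => /(_ isT).
have -> : S^-1 * c <= 2^-1.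
  by rewrite mulrC ler_pdivrMr//; rewrite /S; lra.
move=> /(_ isT); apply/negP; rewrite -ltNge.
have -> : S^-1 * D + S^-1 ^+ 2 * K = S^-1 * (D + K / S).
  by rewrite expr2 mulrDr -mulrA (mulrC K).
rewrite pmulr_rlt0 ?invr_gt0//.
suff : K / S < - D by lra.
rewrite ltr_pdivrMr//.
have : - D * (2 * K / - D) = 2 * K by rewrite mulrC divfK// oppr_eq0 lt_eqF.
have : 0 <= - D * c by rewrite mulr_ge0// oppr_ge0 ltW.
rewrite /S; lra.
Qed.

End bounded_on_B.
End gibbs.

Section gibbs_minimizer.
Context d (T : measurableType d) (R : realType) (Q : probability T R).
Context (n : nat) (X : 'I_n -> T -> R).
Local Notation dot := (lin_form X).
Local Notation Z := (partition_fun Q X).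

Lemma box0 (r : R) : 0 <= r -> box (n := n) r 0.
Proof. by move=> r0 i; rewrite mxE oppr_le0 r0. Qed.

(** Here l minimizes Z over the box, and the first-order condition is tested
    against a point m of the box at which the sum of the m_i V_i is least. *)
Lemma exists_box_critical_point B (r : R) : measurable B ->
  (forall i, bounded_measurable B (X i)) -> 0 <= r ->
  exists2 l, box r l &
  \sum_i l ord0 i * moment Q X B l i <= - r * \sum_i `|moment Q X B l i|.
Proof.
move=> mB bX r0.
have [||l /set_mem bl min_l] := @compact_EVT_min _ R (Z B) _ _ (@box_compact R n r).
- by exists 0; exact: box0.
- exact/continuous_subspaceT/continuous_partition_fun.
have min_box m : box r m -> Z B l <= Z B m by move=> bm; apply: min_l; exact/mem_set.
exists l => //.
set V := moment Q X B l.
pose m : 'rV[R]_n := \row_i (- r * Num.sg (V i)).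
have bm : box r m.
  move=> i; rewrite mxE; case: sgrP => _; lra.
have := box_minimizer_first_order mB bX bl bm min_box.
rewrite Rintegral_lin_form_expR// -/V.
under eq_bigr do rewrite !mxE mulrBl.
rewrite sumrB subr_ge0 => /le_trans; apply.
rewrite mulr_sumr le_eqVlt; apply/orP; left; apply/eqP.
by apply: eq_bigr => i _; rewrite -mulrA -normrEsg.
Qed.

Section truncation.
Variable B : (set T)^nat.
Hypothesis mB : forall k, measurable (B k).
Hypothesis ndB : nondecreasing_seq B.
Hypothesis BT : \bigcup_k B k = setT.
Hypothesis mX : forall i, measurable_fun setT (X i).
Hypothesis bX : forall k i, bounded_measurable (B k) (X i).

Lemma measurable_lin_form l : measurable_fun setT (dot l).
Proof.
by apply: measurable_sum => i; apply: measurable_funM.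
Qed.

Let mE l : measurable_fun setT (fun x => (expR (dot l x))%:E).
Proof. apply/measurable_EFinP/measurableT_comp => //; exact: measurable_lin_form. Qed.

Let ZE k l : (Z (B k) l)%:E = (\int[Q]_(x in B k) (expR (dot l x))%:E)%E.
Proof.
rewrite fineK//; apply: (integrable_fin_num (mB k)).
exact/bounded_measurable_integrable/bounded_measurable_expR_lin_form.
Qed.

Lemma le_partition_fun l : {homo (fun k => Z (B k) l) : j k / (j <= k)%N >-> j <= k}.
Proof.
move=> j k jk; rewrite -lee_fin !ZE; apply: ge0_subset_integral => //.
- exact: measurable_funTS.
- by rewrite -subsetEset; exact: ndB.
Qed.

(** A Dini argument: Z (B k) l increases with k to an integral that exceeds a',
    and the box is compact, so that one k serves all l. *)
Lemma exists_truncation (a a' r : R) : a' < a ->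
  (forall l, (a%:E <= \int[Q]_x (expR (dot l x))%:E)%E) ->
  exists k, forall l, box r l -> a' < Z (B k) l.
Proof.
move=> aa' Qa.
have pointwise l : exists k, a' < Z (B k) l.
  apply: contrapT => /forallNP nZ.
  suff : (a%:E <= a'%:E)%E by rewrite lee_fin leNgt aa'.
  rewrite (le_trans (Qa l))// -BT.
  have E0 i x : B i x -> (0 <= (expR (dot l x))%:E)%E.
    by move=> _; rewrite lee_fin expR_ge0.
  have cvgZ := @ge0_nondecreasing_set_cvg_integral _ _ _ B _ Q ndB mB
    (fun i => measurable_funTS (mE l)) E0.
  rewrite -(cvg_lim _ cvgZ)//; apply: lime_le.
    by apply/cvg_ex; eexists; exact: cvgZ.
  by apply: nearW => k; rewrite -ZE lee_fin leNgt; apply/negP.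
have /compact_near_coveringP/(_ _ \oo (fun k l => a' < Z (B k) l)) := @box_compact R n r.
case=> [l _|k _ boxk]; last by exists k => l; apply: boxk => /=.
have [k ak] := pointwise l.
have cZ := @continuous_partition_fun _ _ _ Q _ X _ (mB k) (bX k) l.
exists ([set m | a' < Z (B k) m], [set j | (k <= j)%N]).
  split; last exact: nbhs_infty_ge.
  exact: (pseudometric_normed_Zmodule.cvgr_gt _ cZ _ ak).
move=> [m j] /= [Zm kj]; exact: lt_le_trans Zm (le_partition_fun _ kj).
Qed.

End truncation.
End gibbs_minimizer.

(** * Tilted probabilities *)

Section tilting.
Context d (T : measurableType d) (R : realType) (Q : probability T R).
Context (n : nat) (X : 'I_n -> T -> R).
Local Notation dot := (lin_form X).
Local Notation Z := (partition_fun Q X).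
Hypothesis mX : forall i, measurable_fun setT (X i).

(** The density is expR (l.X) / Z on B and 0 elsewhere: its logarithm is affine
    in X on B, which makes the entropy explicit. *)
Lemma exists_tilted_probability B l : measurable B ->
  (forall i, bounded_measurable B (X i)) -> 0 < Z B l ->
  exists P : probability T R, [/\ P (~` B) = 0%E,
    forall i, \int[P]_x X i x = moment Q X B l i / Z B l &
    relative_entropy P Q =
      (\sum_i l ord0 i * \int[P]_x X i x - ln (Z B l))%:E].
Proof.
move=> mB bX Z0.
pose g x := \1_B x * (expR (dot l x) / Z B l).
have mdot := measurable_lin_form mX l.
have mg : measurable_fun setT g.
  apply: measurable_funM => //; apply: measurable_funM => //; exact: measurableT_comp.
have g0 x : 0 <= g x by rewrite !mulr_ge0// ?expR_ge0// invr_ge0 ltW.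
have gB x : B x -> g x = expR (dot l x) / Z B l.
  by move=> Bx; rewrite /g indicE mem_set// mul1r.
have gNB x : ~ B x -> g x = 0 by move=> Bx; rewrite /g indicE memNset// mul0r.
have bE := bounded_measurable_expR_lin_form bX l.
have iE := bounded_measurable_integrable Q mB bE.
have gBE (f : T -> \bar R) :
    (\int[Q]_x (f x * (g x)%:E) = \int[Q]_(x in B) (f x * (g x)%:E))%E.
  rewrite [RHS]integral_mkcond; apply: eq_integral => x _.
  by rewrite patchE; case: ifPn => //; rewrite notin_setE => /gNB ->; rewrite mule0.
have g1 : (\int[Q]_x (g x)%:E = 1)%E.
  under eq_integral do rewrite -[(g _)%:E]mul1e.
  rewrite gBE; under eq_integral => x /set_mem Bx do rewrite mul1e gB// mulrC EFinM.
  rewrite integralZl// -[X in (_ * X)%E]fineK; last exact: integrable_fin_num iE.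
  by rewrite -EFinM mulVf// gt_eqF.
have [P Pg] := exists_probability_density mg g0 g1.
have PB : P (~` B) = 0%E.
  rewrite Pg; last exact: measurableC.
  by apply: integral0_eq => x /gNB ->.
have iX i : P.-integrable setT (EFin \o X i).
  apply/(negligible_integrable (measurableC mB) measurableT _ PB).
    exact/measurable_EFinP.
  by rewrite setTD setCK; exact: bounded_measurable_integrable.
have X_moment i : \int[P]_x X i x = moment Q X B l i / Z B l.
  rewrite /Rintegral (integral_density mg Pg)//; last exact: iX.
  rewrite gBE /moment mulrC -RintegralZl//; last first.
    by apply: bounded_measurable_integrable => //; exact: bounded_measurableM.
  congr fine; apply: eq_integral => x /set_mem Bx.
  by rewrite gB// -EFinM; congr EFin; rewrite [LHS]mulrA [LHS]mulrC.
exists P; split=> //.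
rewrite (relative_entropy_density mg g0 Pg).
have dotE : EFin \o dot l = (fun x => \sum_i (l ord0 i)%:E * (X i x)%:E)%E.
  apply/funext => x; rewrite /= /lin_form -sumEFin.
  by apply: eq_bigr => i _; rewrite EFinM.
have ilX i : P.-integrable setT (fun x => (l ord0 i)%:E * (X i x)%:E)%E.
  by apply: integrableZl => //; exact: iX.
have idot : P.-integrable setT (EFin \o dot l).
  by rewrite dotE; exact: integrable_sum.
transitivity (\int[P]_x ((dot l x)%:E - (ln (Z B l))%:E))%E.
  apply: ae_eq_integral => //.
  - by apply/measurable_EFinP; exact: measurableT_comp.
  - by apply/measurable_EFinP; exact: measurable_funB.
  exists (~` B); split; [exact: measurableC|exact: PB|].
  move=> x /=; apply: contra_not => Bx _.
  by rewrite gB// ln_div ?posrE ?expR_gt0// expRK.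
rewrite integralB_EFin//; last exact: finite_measure_integrable_cst.
rewrite probability_integral_cst EFinB; congr (_ - _)%E.
rewrite -[in LHS]/(EFin \o dot l) dotE integral_sum//.
rewrite -sumEFin; apply: eq_bigr => i _.
rewrite integralZl//; last exact: iX.
by rewrite EFinM fineK//; apply: integrable_fin_num => //; exact: iX.
Qed.

(** Tilting at the critical point of the box gives
    0 <= H = l.E X - ln Z <= b - r sum_i |E X_i|, from which both bounds follow
    when r is large. *)
Lemma exists_low_entropy_probability (B : (set T)^nat) (a b eps : R) :
  (forall k, measurable (B k)) -> nondecreasing_seq B -> \bigcup_k B k = setT ->
  (forall k i, bounded_measurable (B k) (X i)) ->
  (forall l, ((expR (- a))%:E <= \int[Q]_x (expR (dot l x))%:E)%E) ->
  a < b -> 0 < eps ->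
  exists P : probability T R, exists k, [/\ P (~` B k) = 0%E,
    (relative_entropy P Q <= b%:E)%E &
    forall i, `|\int[P]_x X i x| < eps].
Proof.
move=> mB ndB BT bX Qa ab eps0.
have a0 : 0 <= a.
  have := Qa 0; under eq_integral.
    move=> x _; rewrite (_ : dot 0 x = 0) ?expR0; last first.
      by rewrite /lin_form big1// => i _; rewrite mxE mul0r.
    over.
  by rewrite probability_integral_cst lee_fin expR_le1 oppr_le0.
(* Any r with r * eps > b will do, since r |E X_i| <= b. *)
pose r := (b + 1) / eps.
have r0 : 0 < r by rewrite divr_gt0//; lra.
have ab' : expR (- b) < expR (- a) by rewrite ltr_expR ltrN2.
have [k boxk] := @exists_truncation _ _ _ Q _ X _ mB ndB BT mX bX _ _ r ab' Qa.
have [l bl momentl] := @exists_box_critical_point _ _ _ Q _ X _ r (mB k) (bX k) (ltW r0).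
have Zl := boxk _ bl; have Z0 : 0 < Z (B k) l by exact: lt_trans (expR_gt0 _) Zl.
have [P [PB X_moment entP]] := exists_tilted_probability (mB k) (bX k) Z0.
have lnZ : - ln (Z (B k) l) < b.
  by rewrite ltrNl -(expRK (- b)) ltr_ln ?posrE ?expR_gt0.
have sum_le : \sum_i l ord0 i * \int[P]_x X i x <= - r * \sum_i `|\int[P]_x X i x|.
  under eq_bigr do rewrite X_moment mulrA.
  rewrite -mulr_suml; under [in leRHS]eq_bigr do rewrite X_moment normrM.
  rewrite -mulr_suml mulrA [`|_^-1|]ger0_norm ?invr_ge0 ?(ltW Z0)//.
  by rewrite ler_wpM2r// invr_ge0 ltW.
have := relative_entropy_ge0 P Q; rewrite entP lee_fin => ent0.
have sum0 : 0 <= \sum_i `|\int[P]_x X i x| by exact: sumr_ge0.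
exists P, k; split => //; first by rewrite entP lee_fin; nra.
move=> i; rewrite -(ltr_pM2l r0).
have -> : r * eps = b + 1 by rewrite /r divfK// gt_eqF.
have : r * `|\int[P]_x X i x| <= r * \sum_i `|\int[P]_x X i x|.
  rewrite ler_wpM2l ?(ltW r0)// (bigD1 i)//= lerDl; exact: sumr_ge0.
lra.
Qed.

End tilting.

(** * Topology and Borel sets of the torus *)

Section torus_topology.
Context (R : realType) (d : nat).
Local Notation T := (torus R d).

Lemma continuous_pi_torus : continuous (\pi_T : 'rV[R]_d -> T).
Proof. exact: (@pi_continuous _ T). Qed.

Lemma torus_continuousP (Z : topologicalType) (f : T -> Z) :
  continuous (fun x : 'rV[R]_d => f (\pi_T x)) -> continuous f.
Proof. by move=> cf; apply/(@quotient_continuous _ T). Qed.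

Lemma pi_torusP (x y : 'rV[R]_d) : reflect (\pi_T x = \pi_T y) (congr_Zd x y).
Proof. exact: (@eqmodP _ (congr_Zd_equiv R d)). Qed.

Lemma torus_compact : compact [set: T].
Proof.
pose cube : set 'rV[R]_d := [set x | forall i, `[0, 1]%classic (x ord0 i)].
have -> : [set: T] = (\pi_T : 'rV[R]_d -> T) @` cube.
  apply/seteqP; split => // t _.
  pose y : 'rV[R]_d := \row_i (repr t ord0 i - (Num.floor (repr t ord0 i))%:~R).
  exists y.
    move=> i /=; rewrite in_itv/= mxE.
    have := floor_le (repr t ord0 i); have := floorD1_gt (repr t ord0 i).
    by rewrite intrD; lra.
  rewrite -[RHS]reprK; apply/pi_torusP/forallP => i.
  by rewrite mxE addrAC subrr add0r rpredN intr_int.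
apply: continuous_compact.
  exact/continuous_subspaceT/continuous_pi_torus.
exact: (@rV_compact R d (fun=> `[0, 1]%classic) (fun=> @segment_compact _ _ _)).
Qed.

Lemma torus_open_measurable (U : set T) : open U -> measurable U.
Proof. by move=> oU; exact: sub_sigma_algebra. Qed.

Lemma torus_continuous_measurable (s : T -> R) :
  continuous s -> measurable_fun [set: T] s.
Proof.
move=> /continuousP cs; apply: (measurability _ (RGenOpens.measurableE R)).
move=> _ [_ [a [b ->] <-]]; rewrite setTI; apply: torus_open_measurable.
by apply: cs; exact: interval_open.
Qed.

Lemma torus_continuous_bounded (s : T -> R) : continuous s ->
  exists M, forall x, `|s x| <= M.
Proof.
move=> cs.
have := continuous_compact (continuous_subspaceT cs) torus_compact.
move/compact_bounded => [M [_ Ms]]; exists (M + 1) => x.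
by apply: (Ms (M + 1)); rewrite ?ltrDl//; exists x.
Qed.

Definition lift_dist (A : set 'rV[R]_d) (x : 'rV[R]_d) := inf [set `|x - a| | a in A].

Lemma lift_dist_le (A : set 'rV[R]_d) x a : A a -> lift_dist A x <= `|x - a|.
Proof. by move=> Aa; apply: ge_inf; [exists 0 => _ [b _ <-]|exists a]. Qed.

Lemma lift_dist_ge (A : set 'rV[R]_d) x r : A !=set0 ->
  (forall a, A a -> r <= `|x - a|) -> r <= lift_dist A x.
Proof.
move=> [a Aa] Ar; apply: lb_le_inf; first by exists `|x - a|, a.
by move=> _ [b Ab <-]; exact: Ar.
Qed.

Lemma lift_dist_continuous (A : set 'rV[R]_d) : A !=set0 -> continuous (lift_dist A).
Proof.
move=> A0 x.
apply/(pseudometric_normed_Zmodule.cvgrPdist_le (FF := nbhs_filter x)) => e e0.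
have lip y z : lift_dist A y - `|y - z| <= lift_dist A z.
  apply: lift_dist_ge => // a Aa; rewrite lerBlDr (le_trans (lift_dist_le _ Aa))//.
  by rewrite [leRHS]addrC -(subrKA z y (- a)) ler_normD.
apply/nbhs_ballP; exists e => //= y; rewrite -ball_normE => /ltW/= xy.
have := lip x y; have := lip y x; rewrite (distrC y x) ler_distl; lra.
Qed.

Section open_approximation.
Variables (U : set T) (oU : open U).
Let A : set 'rV[R]_d := [set x | ~ U (\pi_T x)].

(** The distance in R^d from a representative of t to the lift A of the
    complement of U. Since A is invariant under integer translations, the choice
    of the representative is irrelevant. *)
Definition torus_dist (t : T) := lift_dist A (repr t).

Let lift_dist_pi (x y : 'rV[R]_d) : A !=set0 -> \pi_T x = \pi_T y ->
  lift_dist A x <= lift_dist A y.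
Proof.
move=> A0 /pi_torusP xy; apply: lift_dist_ge => // a Aa.
(* Translating a by the integer vector x - y stays in A. *)
have -> : y - a = x - (a + (x - y)) by rewrite opprD addrA addrAC opprB subrKC.
apply: lift_dist_le; rewrite /A/=.
suff pa : \pi_T (a + (x - y)) = \pi_T a by move: Aa; rewrite /A/= -pa.
apply/pi_torusP/forallP => i; rewrite !mxE addrAC subrr add0r.
by have /forallP := xy; exact.
Qed.

Lemma torus_dist_pi x : A !=set0 -> torus_dist (\pi_T x) = lift_dist A x.
Proof.
move=> A0; apply/eqP; rewrite eq_le.
by rewrite !lift_dist_pi// reprK.
Qed.

Lemma torus_dist_continuous : A !=set0 -> continuous torus_dist.
Proof.
move=> A0; apply: torus_continuousP.
under eq_fun do rewrite torus_dist_pi//.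
exact: lift_dist_continuous.
Qed.

Lemma torus_dist_ge0 t : A !=set0 -> 0 <= torus_dist t.
Proof. by move=> A0; exact: lift_dist_ge. Qed.

Lemma torus_dist_gt0 t : A !=set0 -> U t -> 0 < torus_dist t.
Proof.
move=> A0 Ut; have := continuous_pi_torus; move/continuousP => /(_ _ oU) opU.
have /nbhs_ballP[r /= r0 rU] : nbhs (repr t) ((\pi_T : 'rV[R]_d -> T) @^-1` U).
  by apply: open_nbhs_nbhs; split => //; rewrite /= reprK.
apply: lt_le_trans r0 _; apply: lift_dist_ge => // a Aa.
rewrite leNgt; apply/negP => ra; apply: Aa; apply: rU.
by rewrite -ball_normE.
Qed.

Lemma torus_dist_eq0 t : ~ U t -> torus_dist t = 0.
Proof.
move=> Ut; have At : A (repr t) by rewrite /A/= reprK.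
have A0 : A !=set0 by exists (repr t).
apply/eqP; rewrite eq_le torus_dist_ge0// andbT.
by have := lift_dist_le (repr t) At; rewrite subrr normr0.
Qed.

(** This reduces the mass of open sets to pairings with continuous functions. *)
Lemma open_indic_approx : exists s : nat -> T -> R,
  [/\ forall k, continuous (s k), forall k t, 0 <= s k t,
      forall t, nondecreasing_seq (s ^~ t) &
      forall t, s k t @[k --> \oo] --> (\1_U t : R)].
Proof.
have [A0|/set0P A0] := eqVneq A set0.
  exists (fun _ _ => 1); split=> //.
  - by move=> k; exact: cst_continuous.
  - by move=> t j k _; exact: lexx.
  - move=> t; rewrite indicE mem_set; first exact: cvg_cst.
    apply: contrapT => Ut; suff : A (repr t) by rewrite A0.
    by rewrite /A/= reprK.
exists (fun k t => Num.min 1 (k%:R * torus_dist t)); split.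
- move=> k t; apply: (@continuous_min _ _ (fun=> 1) (fun t => k%:R * torus_dist t)).
    exact: cst_continuous.
  apply: (@continuousM _ _ (fun=> k%:R) torus_dist); first exact: cst_continuous.
  exact: torus_dist_continuous.
- by move=> k t; rewrite le_min ler01 mulr_ge0// torus_dist_ge0.
- move=> t j k jk; rewrite le_min2//.
  by rewrite ler_wpM2r ?torus_dist_ge0// ler_nat.
- move=> t; have [Ut|Ut] := pselect (U t); last first.
    rewrite indicE memNset// torus_dist_eq0//.
    by under eq_fun do rewrite mulr0 min_r//; exact: cvg_cst.
  rewrite indicE mem_set//; apply: cvg_near_cst.
  have u0 := torus_dist_gt0 A0 Ut.
  near=> k; apply/min_idPl; rewrite -ler_pdivrMr//.
  near: k; exact: nbhs_infty_ger.
Unshelve. all: end_near. Qed.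

End open_approximation.
End torus_topology.

(** * Weak topology and random measures *)

Lemma continuous_lincomb (R : realType) (X : topologicalType) n
    (c : 'I_n -> R) (s : 'I_n -> X -> R) :
  (forall i, continuous (s i)) -> continuous (fun x => \sum_i c i * s i x)%R.
Proof.
move=> cs; elim: (index_enum _) => [|i r IH].
  by under eq_fun do rewrite big_nil; exact: cst_continuous.
under eq_fun do rewrite big_cons.
move=> x; apply: (@continuousD _ _ _ (fun x => c i * s i x)%R) (IH x).
by apply: (@continuousM _ _ (fun=> c i) (s i)); [exact: cst_continuous|exact: cs].
Qed.

Section pairing.
Context (R : realType) (d : nat).
Local Notation T := (torus R d).
Implicit Types (s : T -> R) (rho m : fmeas R d).

Lemma integrable_pairing s rho : continuous s -> rho.-integrable setT (EFin \o s).
Proof.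
move=> cs; apply: bounded_measurable_integrable => //; split.
  exact: torus_continuous_measurable.
by have [M sM] := torus_continuous_bounded cs; exists M.
Qed.

Lemma pairingE s rho : continuous s ->
  (\int[rho]_x (s x)%:E = (pairing s rho)%:E)%E.
Proof.
move=> cs; rewrite /pairing /Rintegral fineK//.
by apply: integrable_fin_num => //; exact: integrable_pairing.
Qed.

Lemma le_norm_pairing s rho M : continuous s -> (forall x, `|s x| <= M) ->
  `|pairing s rho| <= M * pairing (cst 1) rho.
Proof.
move=> cs sM; rewrite /pairing (le_trans (le_normr_Rintegral _ _))//.
  exact: integrable_pairing.
have i1 := integrable_pairing rho (@cst_continuous T R 1).
rewrite -RintegralZl//; apply: le_Rintegral => //.
- exact/integrable_norm/integrable_pairing.
- exact: (integrableZl measurableT M i1).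
- by move=> x _; rewrite mulr1.
Qed.

Lemma pairing_sum n (l : 'I_n -> R) (s : 'I_n -> T -> R) rho :
  (forall i, continuous (s i)) ->
  pairing (fun x => \sum_i l i * s i x) rho = \sum_i l i * pairing (s i) rho.
Proof.
move=> cs; have bs i : bounded_measurable setT (s i).
  split; first exact: torus_continuous_measurable.
  by have [M sM] := torus_continuous_bounded (cs i); exists M.
rewrite /pairing/= Rintegral_sum// => [|i].
  by apply: eq_bigr => i _; rewrite RintegralZl//; exact: integrable_pairing.
by apply: bounded_measurableM => //; exact: bounded_measurable_cst.
Qed.

Lemma continuous_pairing (s : continuousType T R) :
  continuous (pairing s : fmeas R d -> R).
Proof.
move=> rho.
have cw : continuous (@pairing_map R d) := @initial_continuous _ _ _.
have cp := @proj_continuous (continuousType T R) (fun=> (R : topologicalType)) s.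
exact: (continuous_comp (cw rho) (cp _)).
Qed.

Lemma measurable_pairing s : continuous s ->
  measurable_fun setT (pairing s : fmeas R d -> R).
Proof.
move=> cs; apply: (measurability _ (RGenOpens.measurableE R)).
move=> _ [_ [a [b ->] <-]]; rewrite setTI; apply: sub_sigma_algebra.
have /continuousP := @continuous_pairing (mkcts cs); apply.
exact: interval_open.
Qed.

(** Pairings with continuous functions are continuous in m. They determine the
    mass of open sets by monotone convergence, and the Dynkin argument extends
    measurability to all Borel sets. *)
Lemma measurable_eval (A : set T) : measurable A ->
  measurable_fun setT (fun m : fmeas R d => m A).
Proof.
have mT : measurable_fun setT (fun m : fmeas R d => m setT).
  rewrite (_ : (fun m => _) = (fun m : fmeas R d => (pairing (cst 1) m)%:E)).
    by apply/measurable_EFinP; apply: measurable_pairing; exact: cst_continuous.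
  apply/funext => m; rewrite -pairingE; last exact: cst_continuous.
  by rewrite -[LHS]mul1e -integral_cst.
move: A; apply: (@dynkin_induction _ _ (@open T)) => //.
- by move=> U V; exact: openI.
- move=> U oU; have [s [cs s0 s_nd s_cvg]] := open_indic_approx oU.
  apply: (@emeasurable_fun_cvg _ _ _ _ (fun k (m : fmeas R d) => (pairing (s k) m)%:E)).
    by move=> k; apply/measurable_EFinP; exact: measurable_pairing.
  move=> m _; under eq_fun do rewrite -pairingE//.
  have -> : m U = (\int[m]_x limn (fun k => (s k x)%:E))%E.
    rewrite -[U]setIT -integral_indic//; last exact: torus_open_measurable.
    apply: eq_integral => x _; apply/esym/cvg_lim => //.
    by apply: cvg_EFin; [exact: nearW|exact: s_cvg].
  apply: cvg_monotone_convergence => //.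
  + by move=> k; apply/measurable_EFinP; exact: torus_continuous_measurable.
  + by move=> k x _; rewrite lee_fin.
  + by move=> x _ j k jk; rewrite lee_fin; exact: s_nd.
- move=> A mA mevA.
  rewrite (_ : (fun m => _) = (fun m : fmeas R d => m setT - m A)%E).
    exact: emeasurable_funB.
  apply/funext => m; rewrite -setTD measureD ?setTI//.
  by rewrite ltey_eq fin_num_measure.
- move=> F mF tF mevF.
  rewrite (_ : (fun m => _) = (fun m : fmeas R d => \sum_(k <oo) m (F k))%E).
    by apply: ge0_emeasurable_sum.
  by apply/funext => m; apply/esym/cvg_lim => //; exact: measure_sigma_additive.
Qed.

End pairing.

Section intensity_measure.
Local Open Scope ereal_scope.
Context (R : realType) (d : nat) (P : probability (fmeas R d) R).
Local Notation T := (torus R d).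

Let intensity0 : intensity P set0 = 0.
Proof. by rewrite /intensity integral0_eq// => m _; rewrite measure0. Qed.

Let intensity_ge0 A : 0 <= intensity P A.
Proof. exact: integral_ge0. Qed.

Let intensity_sigma_additive : semi_sigma_additive (intensity P).
Proof.
move=> F mF tF mUF; rewrite /intensity.
have -> : \int[P]_m m (\bigcup_k F k) = \int[P]_m (\sum_(k <oo) m (F k)).
  by apply: eq_integral => m _; apply/esym/cvg_lim => //; exact: measure_sigma_additive.
rewrite integral_nneseries//; last by move=> k; exact: measurable_eval.
by apply: is_cvg_ereal_nneg_natsum_cond => k _ _; exact: integral_ge0.
Qed.

HB.instance Definition _ := isMeasure.Build _ _ _ (intensity P)
  intensity0 intensity_ge0 intensity_sigma_additive.

Section finite_intensity.
Hypothesis finP : fin_num_fun (intensity P).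

Let mean := intensity P.
HB.instance Definition _ := Measure.on mean.
HB.instance Definition _ := Measure_isFinite.Build _ _ _ mean finP.

Lemma exists_has_intensity_fin_num : exists rho : fmeas R d, has_intensity P rho.
Proof. by exists mean. Qed.

End finite_intensity.

Lemma exists_has_intensity : intensity P setT < +oo ->
  exists rho : fmeas R d, has_intensity P rho.
Proof.
by move=> Poo; apply: exists_has_intensity_fin_num; exact: lty_fin_num_fun.
Qed.

Import HBNNSimple.

(** For indicators this is the definition of the intensity; it passes to simple
    functions by linearity and then to f by monotone convergence. *)
Lemma ge0_campbell (rho : fmeas R d) (f : T -> \bar R) : has_intensity P rho ->
  measurable_fun setT f -> (forall x, 0 <= f x) ->
  \int[P]_m \int[m]_x f x = \int[rho]_x f x.
Proof.
move=> Prho mf f0.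
have campbell_nnsfun (h : {nnsfun T >-> R}) :
    \int[P]_m \int[m]_x (h x)%:E = \int[rho]_x (h x)%:E.
  under eq_integral do rewrite integralT_nnsfun sintegralE.
  rewrite integralT_nnsfun sintegralE ge0_integral_fsum//.
  - apply: eq_fsbigr => r /set_mem[x _ hx].
    rewrite ge0_integralZl//.
    + by congr (_ * _); exact: Prho.
    + exact: measurable_eval.
    + by rewrite lee_fin -hx.
  - by move=> r; apply: measurable_funeM; exact: measurable_eval.
  - by move=> r m _; exact: nnsfun_mulemu_ge0.
pose g := nnsfun_approx measurableT mf.
have mg n : measurable_fun setT (EFin \o g n) by exact/measurable_EFinP.
have nd_g x : nondecreasing_seq (fun n => (g n x)%:E).
  by move=> i j ij; rewrite lee_fin; exact/lefP/nd_nnsfun_approx.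
have limE (mu : {measure set T -> \bar R}) :
    \int[mu]_x f x = limn (fun n => \int[mu]_x (g n x)%:E).
  rewrite -monotone_convergence//; last by move=> n x _; rewrite lee_fin.
  by apply: eq_integral => x _; apply/esym/cvg_lim => //; exact: cvg_nnsfun_approx.
rewrite limE; under [in RHS]eq_fun do rewrite -campbell_nnsfun.
rewrite -monotone_convergence//.
- by apply: eq_integral => m _; exact: limE.
- move=> n; apply: measurable_fun_integral_kernel => [U mU||].
  + exact: measurable_eval.
  + by move=> x; rewrite lee_fin.
  + exact: mg.
- by move=> n m _; apply: integral_ge0 => x _; rewrite lee_fin.
- move=> m _ i j ij; apply: ge0_le_integral => //.
  + by move=> x _; rewrite lee_fin.
  + exact: mg.
  + exact: mg.
  + by move=> x _; exact: nd_g.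
Qed.

Lemma campbell (rho : fmeas R d) (s : T -> R) : has_intensity P rho ->
  continuous s ->
  P.-integrable setT (fun m => (pairing s m)%:E) /\
  \int[P]_m (pairing s m)%:E = (pairing s rho)%:E.
Proof.
move=> Prho cs.
have ms : measurable_fun setT (EFin \o s).
  by apply/measurable_EFinP; exact: torus_continuous_measurable.
have pairing_split m : (pairing s m)%:E =
    \int[m]_x (EFin \o s)^\+ x - \int[m]_x (EFin \o s)^\- x.
  by rewrite -pairingE// integralE.
have ge0_integrable f : measurable_fun setT f -> (forall x, 0 <= f x) ->
    \int[rho]_x f x < +oo -> P.-integrable setT (fun m : fmeas R d => \int[m]_x f x).
  move=> mf f0 fi; apply/integrableP; split.
    by apply: measurable_fun_integral_kernel => // U mU; exact: measurable_eval.
  under eq_integral do rewrite gee0_abs ?integral_ge0//.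
  by rewrite (ge0_campbell Prho).
have ipos : P.-integrable setT (fun m : fmeas R d => \int[m]_x (EFin \o s)^\+ x).
  apply: ge0_integrable => //; first exact: measurable_funepos.
  exact/integral_funepos_lt_pinfty/integrable_pairing.
have ineg : P.-integrable setT (fun m : fmeas R d => \int[m]_x (EFin \o s)^\- x).
  apply: ge0_integrable => //; first exact: measurable_funeneg.
  exact/integral_funeneg_lt_pinfty/integrable_pairing.
under eq_fun do rewrite pairing_split.
split; first exact: integrableB.
rewrite integralB// !(ge0_campbell Prho)//.
- exact: measurable_funeneg.
- exact: measurable_funepos.
Qed.

End intensity_measure.

Section weak_neighborhoods.
Context (R : realType) (d : nat).
Local Notation T := (torus R d).

(** The sets cut out by finitely many pairings generate a filter G. Its image
    under [pairing_map] converges to the image of rho, because convergence in a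
    product is convergence of every coordinate; hence G refines the neighborhoods
    of rho. *)
Lemma nbhs_fmeasP (rho : fmeas R d) (V : set (fmeas R d)) : nbhs rho V ->
  exists (n : nat) (s : 'I_n -> T -> R) (e : R), [/\ 0 < e,
    forall i, continuous (s i) &
    forall m, (forall i, `|pairing (s i) m - pairing (s i) rho| < e) -> V m].
Proof.
pose near_on (p : seq (continuousType T R) * R) : set (fmeas R d) :=
  [set m | forall s, s \in p.1 -> `|pairing s m - pairing s rho| < p.2].
pose G := filter_from [set p | 0 < p.2] near_on.
have FG : Filter G.
  apply: filter_from_filter; first by exists ([::], 1) => /=.
  move=> [s1 e1] [s2 e2] /= e10 e20; exists (s1 ++ s2, Num.min e1 e2).
    by rewrite /= lt_min e10.
  move=> m /= sm; split=> s /= ss;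
    have /sm : s \in s1 ++ s2 by rewrite mem_cat ss ?orbT.
    by rewrite lt_min => /andP[].
  by rewrite lt_min => /andP[].
have cvgG : (@pairing_map R d @ G) --> pairing_map rho.
  apply/cvg_sup => s W [_ [[B oB <-] /= Brho BW]]; apply: (filterS BW).
  have : nbhs (pairing s rho) B by exact: open_nbhs_nbhs.
  move=> /nbhs_ballP[e /= e0 eB]; exists ([:: s], e) => //= m sm.
  have {}sm := sm s (mem_head _ _).
  by apply: eB; rewrite -ball_normE /= distrC.
rewrite nbhsE => -[_ [[W oW <-] /= Wrho] WV].
have /cvgG : nbhs (pairing_map rho) W by exact: open_nbhs_nbhs.
move=> [[ss e] /= e0 sW].
exists (size ss), (fun i => tnth (in_tuple ss) i), e; split => //.
  by move=> i; exact: cts_fun.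
move=> m sm; apply: WV; apply: sW => s /= /seq_tnthP[i ->]; exact: sm.
Qed.

End weak_neighborhoods.

(** * The envelope *)

Section envelope.
Local Open Scope ereal_scope.
Context (R : realType) (d : nat) (R0 : probability (fmeas R d) R).
Local Notation T := (torus R d).
Implicit Types rho m : fmeas R d.

Lemma Lstar_ge (s : T -> R) rho : continuous s ->
  (pairing s rho)%:E - log_laplace R0 s <= Lstar R0 rho.
Proof. by move=> cs; apply: ereal_sup_ubound; exists (mkcts cs). Qed.

Lemma Lstar_ge0 rho : 0 <= Lstar R0 rho.
Proof.
apply: le_trans (Lstar_ge rho (@cst_continuous _ _ 0%R)).
have pairing0 m : pairing (fun=> 0%R) m = 0%R by rewrite /pairing Rintegral_cst// mul0r.
rewrite pairing0 /log_laplace.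
under eq_integral do rewrite pairing0 expR0.
by rewrite probability_integral_cst lne1 oppe0 adde0.
Qed.

Lemma Init_ge0 rho : 0 <= Init R0 rho.
Proof. by apply: le_ereal_inf_tmp => _ [P _ <-]; exact: relative_entropy_ge0. Qed.

Lemma Lstar_lower_semicontinuous : lower_semicontinuous (Lstar R0).
Proof.
move=> rho a /ereal_sup_gt[_ [s _ <-]].
case: (log_laplace R0 s) (@Lstar_ge s ^~ (@cts_fun _ _ s)) => [c| |] Ls asc.
- have : (a + c < pairing s rho)%R by move: asc; rewrite -EFinB lte_fin; lra.
  move=> /(pseudometric_normed_Zmodule.cvgr_gt _ (@continuous_pairing _ _ s rho)) V.
  exists [set m | (a + c < pairing s m)%R] => // m /= am.
  by apply: lt_le_trans (Ls m); rewrite -EFinB lte_fin; lra.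
- by rewrite addeNy in asc.
- exists setT; first exact: filterT.
  by move=> m _; apply: lt_le_trans (Ls m); rewrite addey// ltry.
Qed.

Lemma Lstar_le_Init rho : Lstar R0 rho <= Init R0 rho.
Proof.
apply: le_ereal_inf_tmp => _ [P Prho <-]; apply: ge_ereal_sup => _ [s _ <-].
have cs : continuous s by exact: cts_fun.
have [iP <-] := campbell Prho cs.
apply: donsker_varadhan => //; exact: measurable_pairing.
Qed.

(** The bound on [Lstar] at linear combinations of the s_i is the exponential
    moment hypothesis of [exists_low_entropy_probability] for the centered
    pairings X_i. Truncating on the total mass bounds every X_i and keeps the
    intensity finite. *)
Lemma exists_nearby_intensity rho (a b e : R) n (s : 'I_n -> T -> R) :
  Lstar R0 rho <= a%:E -> (a < b)%R -> (0 < e)%R -> (forall i, continuous (s i)) ->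
  exists m, Init R0 m <= b%:E /\
    forall i, (`|pairing (s i) m - pairing (s i) rho| < e)%R.
Proof.
move=> La ab e0 cs.
pose X i (m : fmeas R d) := (pairing (s i) m - pairing (s i) rho)%R.
pose mass := (pairing (cst 1%R) : fmeas R d -> R).
have mass_ge0 m : (0 <= mass m)%R by exact: Rintegral_ge0.
have mass_setT m : m setT = (mass m)%:E.
  rewrite -pairingE; last exact: cst_continuous.
  by rewrite -[LHS]mul1e -integral_cst.
have mmass : measurable_fun setT mass.
  by apply: measurable_pairing; exact: cst_continuous.
pose B k := [set m | (mass m <= k%:R)%R].
have mB k : measurable (B k).
  by rewrite -[B k]setTI; apply: (measurable_fun_ler mmass (measurable_cst _)).
have ndB : nondecreasing_seq B.
  by move=> j k jk; apply/subsetPset => m /= /le_trans; apply; rewrite ler_nat.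
have BT : \bigcup_k B k = setT.
  apply/seteqP; split => // m _; exists (Num.bound (mass m)) => //=.
  by rewrite /B/= ltW// archi_boundP.
have mX i : measurable_fun setT (X i).
  by apply: measurable_funB => //; exact: measurable_pairing.
have bX k i : bounded_measurable (B k) (X i).
  split; first exact: measurable_funTS.
  have [M sM] := torus_continuous_bounded (cs i).
  have M0 : (0 <= M)%R by apply: le_trans (sM point); exact: normr_ge0.
  exists (M * k%:R + `|pairing (s i) rho|)%R => m /= Bm.
  rewrite (le_trans (ler_normB _ _))// lerD2r.
  by rewrite (le_trans (le_norm_pairing _ (cs i) sM))// ler_wpM2l.
have dotX (l : 'rV[R]_n) m : let f := (fun x => \sum_i l ord0 i * s i x)%R in
    lin_form X l m = (pairing f m - pairing f rho)%R.
  rewrite /= !pairing_sum// /lin_form -sumrB.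
  by apply: eq_bigr => i _; rewrite mulrBr.
have Qa l : (expR (- a))%:E <= \int[R0]_m (expR (lin_form X l m))%:E.
  set f := (fun x => \sum_i l ord0 i * s i x)%R.
  have cf : continuous f by exact: continuous_lincomb.
  under eq_integral do rewrite dotX expRD mulrC EFinM.
  rewrite ge0_integralZl//; last first.
    apply/measurable_EFinP; apply: measurableT_comp => //; exact: measurable_pairing.
  have := le_trans (Lstar_ge rho cf) La; rewrite /log_laplace.
  case: (\int[R0]_m _) => [I| |].
  - rewrite /lne; case: ifPn => [_|]; first by rewrite addey.
    rewrite -ltNge => I0; rewrite -EFinB -EFinM !lee_fin => h.
    rewrite -[in leRHS](lnK I0) -expRD ler_expR; lra.
  - by move=> _; rewrite gt0_muley ?leey// lte_fin expR_gt0.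
  - by rewrite /= addey.
have [P [k [PB entP smallX]]] :=
  exists_low_entropy_probability mX mB ndB BT bX Qa ab e0.
have : intensity P setT < +oo.
  rewrite /intensity (ge0_negligible_integral (measurableC (mB k)) _ _ _ PB)//;
    last exact: measurable_eval.
  rewrite setTD setCK; apply: (@le_lt_trans _ _ (\int[P]_(m in B k) k%:R%:E)).
    apply: ge0_le_integral => //.
    - by apply: measurable_funTS; exact: measurable_eval.
    - by move=> m Bm; rewrite mass_setT lee_fin.
  by rewrite integral_cst// -ge0_fin_numE ?mule_ge0// fin_numM// fin_num_measure.
move=> /exists_has_intensity[m Pm]; exists m; split.
  by apply: le_trans entP; apply: ereal_inf_lbound; exists P.
move=> i; have := smallX i; congr (`|_| < _)%R.
have [ip pE] := campbell Pm (cs i).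
rewrite /Rintegral/=; under eq_integral do rewrite /X EFinB.
rewrite integralB//; last exact: finite_measure_integrable_cst.
by rewrite pE probability_integral_cst.
Qed.

(** If the inequality failed at rho, some neighborhood of rho would satisfy
    K > b > Lstar rho, yet contain a measure at which Init <= b. *)
Lemma le_Lstar_of_le_Init (K : fmeas R d -> \bar R) :
  lower_semicontinuous K -> (forall rho, K rho <= Init R0 rho) ->
  forall rho, K rho <= Lstar R0 rho.
Proof.
move=> lscK KI rho; rewrite leNgt; apply/negP => LK.
have Lfin : Lstar R0 rho \is a fin_num.
  by rewrite ge0_fin_numE ?Lstar_ge0// (lt_le_trans LK)// leey.
move: LK; rewrite -(fineK Lfin); set a := fine _ => aK.
have [b ab bK] : exists2 b, (a < b)%R & b%:E < K rho.
  case: (K rho) aK => [r| |//] aK.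
    by exists ((a + r) / 2)%R; move: aK; rewrite !lte_fin; lra.
  by exists (a + 1)%R; rewrite ?ltry// ltrDl.
have [V /nbhs_fmeasP[n [s [e [e0 cs sV]]]] VK] := lscK _ _ bK.
have La : Lstar R0 rho <= a%:E by rewrite fineK.
have [m [Im sm]] := exists_nearby_intensity La ab e0 cs.
by have := VK _ (sV _ sm); rewrite ltNge (le_trans (KI m)).
Qed.

End envelope.

Unset Implicit Arguments.
Local Open Scope ereal_scope.

Theorem theorem3p2 (R : realType) (d : nat)
    (R0 : probability (fmeas R d) R) :
  [/\ forall rho : fmeas R d, 0 <= Lstar R0 rho,
      forall rho : fmeas R d, 0 <= Init R0 rho &
      is_lsc_envelope (Init R0) (Lstar R0)].
Proof.
split; [exact: Lstar_ge0|exact: Init_ge0|split].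
- exact: Lstar_lower_semicontinuous.
- exact: Lstar_le_Init.
- by move=> K lscK KI rho; exact: le_Lstar_of_le_Init.
Qed.
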